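(* Let $G=(V,E)$ be a $k$-regular graph with $n$ vertices, adjacency matrix $A$, adjacency eigenvalues $\lambda_1\ge\cdots\ge\lambda_n$ (with multiplicity), and distinct adjacency eigenvalues $k=\theta_0>\theta_1>\cdots>\theta_d$ with $d\ge3$. Let $\Delta_3=\max_{u\in V}\{(A^3)_{uu}\}$ and let $\theta_s$ be the largest eigenvalue such that $\theta_s\le-\frac{\theta_0^2+\theta_0\theta_d-\Delta_3}{\theta_0(\theta_d+1)}$. Let $b=-(\theta_s+\theta_{s-1}+\theta_d)$ and $c=\theta_d\theta_s+\theta_d\theta_{s-1}+\theta_s\theta_{s-1}$. For $q\in\mathbb{R}_3[x]$ put $W(q):=\max_{u\in V}\{(q(A))_{uu}\}$ and $\lambda(q):=\min_{2\le j\le n}\{q(\lambda_j)\}$, and, when $q(\lambda_1)>\lambda(q)$, put $R(q):=n\,\frac{W(q)-\lambda(q)}{q(\lambda_1)-\lambda(q)}$. Then, for $p(x)=x^3+bx^2+cx$, $$\mathrm{eq}_4(G)\le R(p)= n\,\frac{\Delta_3-\theta_0(\theta_s+\theta_{s-1}+\theta_d)-\theta_s\theta_{s-1}\theta_d}{(\theta_0-\theta_s)(\theta_0-\theta_{s-1})(\theta_0-\theta_d)}.$$ Moreover, this is the best possible bound of this type: $R(q)\ge R(p)$ for every $q\in\mathbb{R}_3[x]$ with $q(\lambda_1)>\lambda(q)$.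
   Context: Graphs are finite, simple and undirected; $d(u,v)$ is the shortest-path distance. $\mathbb{R}_3[x]$ is the set of real polynomials of degree at most $3$. A set $S\subseteq V$ is $4$-equidistant if $d(u,v)=4$ for all distinct $u,v\in S$, and $\mathrm{eq}_4(G)$ is the maximum size of such a set. (The ratio-type bound states that $\mathrm{eq}_4(G)\le R(q)$ for every regular $G$ and every $q\in\mathbb{R}_3[x]$ with $q(\lambda_1)>\lambda(q)$.) *)

(* Defs.v *)
From mathcomp Require Import all_boot all_order all_algebra.
From mathcomp Require Import reals.

Set Implicit Arguments.
Unset Strict Implicit.
Unset Printing Implicit Defensive.

Import Order.TTheory GRing.Theory Num.Theory.
Local Open Scope ring_scope.

Definition simple_graph (V : finType) (e : rel V) : Prop :=
  symmetric e /\ irreflexive e.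

Definition regular_graph (V : finType) (e : rel V) (k : nat) : Prop :=
  forall u : V, #|[set v | e u v]| = k.

Definition has_walk (V : finType) (e : rel V) (m : nat) (u v : V) : bool :=
  [exists w : m.-tuple V, path e u w && (last u w == v)].

(* d(u, v) = m, as a relation: it fails for every m when u and v lie in
   different components, so such vertices are not at any finite distance. *)
Definition at_distance (V : finType) (e : rel V) (m : nat) (u v : V) : bool :=
  has_walk e m u v && [forall j : 'I_m, ~~ has_walk e j u v].

Definition equidistant (V : finType) (e : rel V) (m : nat) (S : {set V}) : bool :=
  [forall u in S, forall v in S, (u != v) ==> at_distance e m u v].

Definition eq_number (V : finType) (e : rel V) (m : nat) : nat :=
  \max_(S : {set V} | equidistant e m S) #|S|.

Definition adjmx (R : realType) (n : nat) (e : rel 'I_n) : 'M[R]_n :=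
  \matrix_(u, v) (e u v)%:R.

(* lam`_0 >= lam`_1 >= ... are the roots of the characteristic polynomial,
   listed with multiplicity. *)
Definition is_spectrum (R : realType) (n : nat) (A : 'M[R]_n)
    (lam : n.-tuple R) : Prop :=
  sorted >=%R lam /\ char_poly A = \prod_(x <- lam) ('X - x%:P).

Definition is_distinct_spectrum (R : realType) (n : nat) (A : 'M[R]_n)
    (theta : seq R) : Prop :=
  sorted >%R theta /\ forall x : R, (x \in theta) = eigenvalue A x.

(* The default value of the iterated maximum is itself a diagonal entry, so
   this is the true maximum even when all diagonal entries are negative. *)
Definition max_diag (R : realType) (m : nat) (M : 'M[R]_m.+1) : R :=
  \big[Num.max/M ord0 ord0]_(u < m.+1) M u u.

Definition Wq (R : realType) (m : nat) (A : 'M[R]_m.+1) (q : {poly R}) : R :=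
  max_diag (horner_mx A q).

(* The indices of lam start at 0, so this is the minimum over all eigenvalues,
   with multiplicity, except one copy of the largest; for at least two
   eigenvalues the default value is one of the values ranged over. *)
Definition lambdaq (R : realType) (n : nat) (lam : n.-tuple R)
    (q : {poly R}) : R :=
  \big[Num.min/q.[lam`_1]]_(1 <= j < n) q.[lam`_j].

Definition Rq (R : realType) (m : nat) (A : 'M[R]_m.+1) (lam : m.+1.-tuple R)
    (q : {poly R}) : R :=
  m.+1%:R * ((Wq A q - lambdaq lam q) / (q.[lam`_0] - lambdaq lam q)).

(* Main.v *)
(* A polynomial q that is nonnegative on the spectrum of the symmetric matrix A
   satisfies q(A) = r(A)^2, where r interpolates sqrt q on the spectrum: this
   replaces the spectral theorem throughout. Applied to p - lambda(p) and the
   indicator vector of a 4-equidistant set, it gives the ratio bound.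
   For optimality let u attain Delta_3. The functional f |-> f(A)_uu depends on
   cubics f only through f_0 + f_2 k + f_3 Delta_3, and it is a combination of
   the evaluations at theta_0, theta_s, theta_(s-1), theta_d. Its weight at
   theta_0 is R(p)/n and the other three are nonnegative: for theta_s and
   theta_(s-1) this is exactly the choice of s, and for theta_d it holds because
   (x - theta_0)(x - theta_s)(x - theta_(s-1)) <= 0 on the spectrum. *)
Require Import Defs.
From mathcomp Require Import all_boot all_order all_algebra.
From mathcomp Require Import reals.
From mathcomp Require Import ring lra.

Set Implicit Arguments.
Unset Strict Implicit.
Unset Printing Implicit Defensive.

Import Order.TTheory GRing.Theory Num.Theory.
Local Open Scope ring_scope.

(** * Polynomials in a symmetric matrix *)

Section SymmetricMatrices.

Variables (R : rcfType) (n : nat) (A : 'M[R]_n.+1).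
Hypothesis Asym : A^T = A.

Lemma trmx_horner_mx (q : {poly R}) : (horner_mx A q)^T = horner_mx A q.
Proof.
elim/poly_ind: q => [|q c IHq]; first by rewrite rmorph0 trmx0.
rewrite rmorphD rmorphM /= horner_mx_C horner_mx_X raddfD /= tr_scalar_mx.
rewrite trmx_mul IHq Asym.
by congr (_ + _); apply: comm_mx_horner.
Qed.

Lemma horner_mx_sqr_diag (r : {poly R}) u :
  horner_mx A (r ^+ 2) u u = \sum_v horner_mx A r u v ^+ 2.
Proof.
rewrite rmorphXn /= expr2 !mxE; apply: eq_bigr => v _.
by rewrite -{2}trmx_horner_mx mxE expr2.
Qed.

Lemma horner_mx_sqr_diag_eq0 (r : {poly R}) :
  (forall u, horner_mx A (r ^+ 2) u u <= 0) -> horner_mx A r = 0.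
Proof.
move=> r0; apply/matrixP => u v; rewrite mxE.
have s0 : \sum_w horner_mx A r u w ^+ 2 == 0.
  rewrite eq_le -horner_mx_sqr_diag r0 horner_mx_sqr_diag.
  by apply: sumr_ge0 => w _; apply: sqr_ge0.
move: s0; rewrite psumr_eq0 => [/allP/(_ v (mem_index_enum _))|w _].
  by rewrite /= sqrf_eq0 => /eqP.
exact: sqr_ge0.
Qed.

(** A symmetric matrix yields no nonzero nilpotents: the square of [r ^+ N.+1] is a multiple of
    [r ^+ N.+2], so it has zero diagonal at [A], which forces [r ^+ N.+1] to vanish there. *)
Lemma horner_mx_exp_eq0 (r : {poly R}) N :
  horner_mx A (r ^+ N.+1) = 0 -> horner_mx A r = 0.
Proof.
elim: N => [|N IHN]; first by rewrite expr1.
move=> rN; apply: IHN; apply: horner_mx_sqr_diag_eq0 => u.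
have -> : (r ^+ N.+1) ^+ 2 = r ^+ N.+2 * r ^+ N.
  by rewrite -exprM -exprD; congr (_ ^+ _); rewrite muln2 -addnn !addSn addnS.
by rewrite rmorphM /= rN mul0r mxE.
Qed.

(** * Functional calculus on the spectrum *)

Variable lam : seq R.
Hypothesis Alam : char_poly A = \prod_(x <- lam) ('X - x%:P).

(** The characteristic polynomial divides a power of the squarefree [mu], so Cayley-Hamilton makes
    [mu] nilpotent at [A], hence zero; and [mu] divides [q]. *)
Lemma horner_mx_eq0 (q : {poly R}) :
  (forall x, x \in lam -> q.[x] = 0) -> horner_mx A q = 0.
Proof.
move=> q0; set mu := \prod_(x <- undup lam) ('X - x%:P).
have dvd_exp s : {subset s <= lam} ->
    \prod_(x <- s) ('X - x%:P) %| mu ^+ size s.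
  elim: s => [|x s IHs] sl; first by rewrite big_nil expr0 dvdpp.
  rewrite big_cons exprS dvdp_mul //; last first.
    by apply: IHs => y ys; rewrite sl // inE ys orbT.
  by rewrite dvdp_XsubCl root_prod_XsubC mem_undup sl // mem_head.
have mu0 : horner_mx A mu = 0.
  apply: (@horner_mx_exp_eq0 _ (size lam)).
  have /dvdpP [r ->] : char_poly A %| mu ^+ (size lam).+1.
    by rewrite Alam exprS dvdp_mull // dvd_exp.
  by rewrite rmorphM /= Cayley_Hamilton mulr0.
have /dvdpP [r ->] : mu %| q.
  apply: uniq_roots_dvdp; last by rewrite uniq_rootsE undup_uniq.
  by apply/allP => x; rewrite mem_undup => /q0 qx; apply/eqP.
by rewrite rmorphM /= mu0 mulr0.
Qed.

Lemma eigenvalue_mem a : eigenvalue A a = (a \in lam).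
Proof. by rewrite eigenvalue_root_char Alam root_prod_XsubC. Qed.

Lemma horner_mx_eq0_root (q : {poly R}) a :
  horner_mx A q = 0 -> a \in lam -> q.[a] = 0.
Proof.
move=> qA0; rewrite -eigenvalue_mem eigenvalue_root_min => mua.
apply/rootP; rewrite -dvdp_XsubCl; apply: dvdp_trans (mxminpoly_min qA0).
by rewrite dvdp_XsubCl.
Qed.

Lemma interpolation (F : R -> R) :
  exists r : {poly R}, forall x, x \in lam -> r.[x] = F x.
Proof.
suff [r rP] : exists r : {poly R}, forall x, x \in undup lam -> r.[x] = F x.
  by exists r => x xl; rewrite rP ?mem_undup.
elim: (undup lam) (undup_uniq lam) => [_|a s IHs /= /andP [as_ us]].
  by exists 0.
have [r rP] := IHs us; pose w := \prod_(x <- s) ('X - x%:P).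
have wa : w.[a] != 0 by rewrite -[_ == 0]/(root _ _) root_prod_XsubC.
(* Newton's correction: [w] vanishes at the earlier nodes but not at [a]. *)
exists (r + ((F a - r.[a]) / w.[a]) *: w) => x.
rewrite inE !hornerE => /orP [/eqP ->|xs]; first by rewrite divfK // addrC subrK.
have /eqP -> : root w x by rewrite root_prod_XsubC.
by rewrite mulr0 addr0 rP.
Qed.

Lemma horner_mx_sqrt (q : {poly R}) :
  (forall x, x \in lam -> 0 <= q.[x]) ->
  exists2 r : {poly R}, horner_mx A q = horner_mx A (r ^+ 2)
    & forall x, x \in lam -> q.[x] = r.[x] ^+ 2.
Proof.
move=> q0; have [r rP] := interpolation (fun x => Num.sqrt q.[x]).
have qr x : x \in lam -> q.[x] = r.[x] ^+ 2.
  by move=> xl; rewrite rP // sqr_sqrtr ?q0.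
exists r => //; apply/eqP; rewrite -subr_eq0 -rmorphB /= horner_mx_eq0 // => x xl.
by rewrite !hornerE qr // subrr.
Qed.

Lemma horner_mx_diag_ge0 (q : {poly R}) u :
  (forall x, x \in lam -> 0 <= q.[x]) -> 0 <= horner_mx A q u u.
Proof.
move=> /horner_mx_sqrt [r -> _]; rewrite horner_mx_sqr_diag.
by apply: sumr_ge0 => v _; apply: sqr_ge0.
Qed.

(** Rigidity, used below to exclude degenerate spectra: [q(A) = r(A)^2] has nonpositive diagonal
    only if [r(A) = 0]. *)
Lemma horner_mx_diag_le0_root (q : {poly R}) a :
    (forall x, x \in lam -> 0 <= q.[x]) ->
    (forall u, horner_mx A q u u <= 0) ->
  a \in lam -> q.[a] = 0.
Proof.
move=> /horner_mx_sqrt [r qr rlam] qd al.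
have r0 : horner_mx A r = 0.
  by apply: horner_mx_sqr_diag_eq0 => u; rewrite -qr.
by rewrite rlam // (@horner_mx_eq0_root r a) // expr0n.
Qed.

(** * Constant column sums and the ratio bound *)

Variable k : R.
Hypothesis Ak : forall v, \sum_u A u v = k.

Lemma horner_mx_colsum (q : {poly R}) v : \sum_u horner_mx A q u v = q.[k].
Proof.
elim/poly_ind: q v => [|q c IHq] v.
  by rewrite rmorph0 horner0 big1 // => u _; rewrite mxE.
rewrite rmorphD rmorphM /= horner_mx_C horner_mx_X !hornerE.
under eq_bigr do rewrite !mxE.
rewrite big_split /= exchange_big /=; congr (_ + _).
  by under eq_bigr do rewrite -mulr_suml IHq; rewrite -mulr_sumr Ak.
rewrite (bigD1 v) //= eqxx big1 ?addr0 // => u /negPf ->.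
by rewrite mulr0n.
Qed.

(** Let [y] be [r(A)] applied to the indicator vector of [S]. Its squared norm is the sum of [q(A)]
    over [S * S], at most [#|S| * W], and its coordinates sum to [#|S| * r(k)]; Cauchy-Schwarz
    compares the two. *)
Lemma card_le_horner_mx (q : {poly R}) (W : R) (S : {set 'I_n.+1}) :
    (forall x, x \in lam -> 0 <= q.[x]) -> k \in lam ->
    (forall u, horner_mx A q u u <= W) ->
    (forall u v, u \in S -> v \in S -> u != v -> horner_mx A q u v = 0) ->
  #|S|%:R * q.[k] <= n.+1%:R * W.
Proof.
move=> /horner_mx_sqrt [r qr rlam] kl qW qS.
have [->|S0] := eqVneq S set0.
  rewrite cards0 mul0r mulr_ge0 // (le_trans _ (qW ord0)) // qr horner_mx_sqr_diag.
  by apply: sumr_ge0 => v _; apply: sqr_ge0.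
pose y w := \sum_(u in S) horner_mx A r w u.
have y2 : \sum_w y w ^+ 2 <= #|S|%:R * W.
  have -> : \sum_w y w ^+ 2 = \sum_(u in S) horner_mx A q u u.
    under eq_bigr => w _ do rewrite expr2 /y mulr_suml.
    rewrite exchange_big /=; apply: eq_bigr => u uS.
    under eq_bigr => w _ do rewrite mulr_sumr.
    (* The terms with [v != u] are entries of [q(A)] between distinct elements of [S]. *)
    rewrite exchange_big /= (bigD1 u) //= [X in _ + X]big1 => [|v /andP [vS vu]].
      rewrite addr0 qr horner_mx_sqr_diag; apply: eq_bigr => w _.
      by rewrite -expr2 -{1}trmx_horner_mx mxE.
    apply: etrans (qS u v uS vS _); last by rewrite eq_sym.
    rewrite qr rmorphXn /= expr2 mxE.
    by apply: eq_bigr => w _; rewrite -{1}trmx_horner_mx mxE.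
  by rewrite mulr_natl -sumr_const; apply: ler_sum => u _.
have y1 : \sum_w y w = #|S|%:R * r.[k].
  rewrite exchange_big /= mulr_natl -sumr_const.
  by apply: eq_bigr => u _; apply: horner_mx_colsum.
(* Cauchy-Schwarz: [0 <= \sum_w (n y_w - \sum y)^2]. *)
have CS : (\sum_w y w) ^+ 2 <= n.+1%:R * \sum_w y w ^+ 2.
  set Y := \sum_w y w; set N : R := n.+1%:R.
  have : 0 <= \sum_(w < n.+1) (N * y w - Y) ^+ 2.
    by apply: sumr_ge0 => w _; apply: sqr_ge0.
  have -> : \sum_(w < n.+1) (N * y w - Y) ^+ 2 =
      N * (N * \sum_w y w ^+ 2 - Y ^+ 2).
    under eq_bigr => w _ do rewrite sqrrB exprMn [N * _]mulrC -mulrnAr -mulrA.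
    rewrite big_split sumrB /= sumr_const card_ord -!mulr_sumr -!mulr_suml.
    by rewrite -[Y ^+ 2 *+ _]mulr_natl -/N -/Y; ring.
  by rewrite pmulr_rge0 ?ltr0Sn // subr_ge0.
have Sgt0 : 0 < #|S|%:R :> R by rewrite ltr0n card_gt0.
rewrite rlam // -(ler_pM2l Sgt0).
apply: le_trans (_ : n.+1%:R * (#|S|%:R * W) <= _); last by rewrite mulrCA.
apply: le_trans (_ : n.+1%:R * \sum_w y w ^+ 2 <= _); last by rewrite ler_pM2l ?ltr0Sn.
by rewrite (le_trans _ CS) // y1 exprMn [_%:R ^+ 2]expr2 -mulrA.
Qed.

End SymmetricMatrices.

(** * Extremal diagonal entries and eigenvalues; walks *)

Lemma max_diag_ge (R : realType) m (M : 'M[R]_m.+1) u : M u u <= max_diag M.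
Proof. exact: (le_bigmax _ (fun u => M u u)). Qed.

Lemma max_diag_attained (R : realType) m (M : 'M[R]_m.+1) :
  exists u, M u u = max_diag M.
Proof.
rewrite /max_diag; elim/big_ind: _ => [|x y [u <-] [v <-]|u _].
- by exists ord0.
- by rewrite /Num.max; case: ifP => _; [exists v | exists u].
- by exists u.
Qed.

Lemma lambdaq_le (R : realType) n (lam : n.-tuple R) (q : {poly R}) x :
  x \in lam -> x != lam`_0 -> lambdaq lam q <= q.[x].
Proof.
move=> /(nthP 0) [[|j] ltj <-]; first by rewrite eqxx.
move=> _; apply: (ge_bigmin_seq _ j.+1 xpredT (fun i => q.[lam`_i])) => //.
by rewrite mem_index_iota; move: ltj; rewrite size_tuple.
Qed.

Lemma le_lambdaq (R : realType) n (lam : n.-tuple R) (q : {poly R}) c :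
  (1 < n)%N -> (forall x, x \in lam -> c <= q.[x]) -> c <= lambdaq lam q.
Proof.
move=> n1 cq; have clam j : (j < n)%N -> c <= q.[lam`_j].
  by move=> ltj; rewrite cq ?mem_nth ?size_tuple.
rewrite /lambdaq big_nat_cond; apply: le_bigmin => [|j]; first exact: clam.
by rewrite andbT => /andP [_ /clam].
Qed.

Lemma has_walkS (V : finType) (e : rel V) j u w v :
  e u w -> has_walk e j w v -> has_walk e j.+1 u v.
Proof.
move=> uw /existsP [p /andP [wp pv]].
by apply/existsP; exists [tuple of w :: p]; rewrite /= uw wp.
Qed.

(** * Cubic polynomials *)

Section Cubics.

Variable R : realType.

Definition cubic (a b c h : R) : {poly R} :=
  a *: 'X^3 + b *: 'X^2 + c *: 'X + h%:P.

Lemma horner_cubic a b c h x :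
  (cubic a b c h).[x] = a * x ^+ 3 + b * x ^+ 2 + c * x + h.
Proof. by rewrite !hornerE. Qed.

Lemma cubicE (q : {poly R}) : (size q <= 4)%N -> q = cubic q`_3 q`_2 q`_1 q`_0.
Proof.
move=> q4; apply/polyP => j; rewrite !coefE.
case: j => [|[|[|[|j]]]] /=; rewrite ?(mulr0, mulr1, addr0, add0r) //.
by rewrite nth_default // (leq_trans q4).
Qed.

Lemma horner_mx_cubic m (A : 'M[R]_m.+1) a b c h :
  horner_mx A (cubic a b c h) =
    a *: A ^+ 3 + b *: A ^+ 2 + c *: A + h%:M.
Proof.
by rewrite !rmorphD /= horner_mx_C !linearZ /= !rmorphXn /= horner_mx_X.
Qed.

(* Lagrange interpolation at [k, x1, x2, x3]; [L x y z] is the value of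
   [f |-> f_3 D + f_2 k + f_0] at [(X - x)(X - y)(X - z)]. *)
Lemma cubic_quadrature (k D x1 x2 x3 a b c h : R) :
    k != x1 -> k != x2 -> k != x3 -> x1 != x2 -> x1 != x3 -> x2 != x3 ->
  let L x y z := D - k * (x + y + z) - x * y * z in
  let f x := (cubic a b c h).[x] in
  a * D + b * k + h =
    L x1 x2 x3 / ((k - x1) * (k - x2) * (k - x3)) * f k
  + L k x2 x3 / ((x1 - k) * (x1 - x2) * (x1 - x3)) * f x1
  + L k x1 x3 / ((x2 - k) * (x2 - x1) * (x2 - x3)) * f x2
  + L k x1 x2 / ((x3 - k) * (x3 - x1) * (x3 - x2)) * f x3.
Proof.
move=> k1 k2 k3 x12 x13 x23 L f; rewrite /f /L !horner_cubic.
field; rewrite !subr_eq0; do ![apply/andP; split] => //; by rewrite eq_sym.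
Qed.

End Cubics.

(** * Spectra of regular graphs *)

Section RegularGraph.

Variables (R : realType) (m : nat) (e : rel 'I_m.+1) (k : nat).
Local Notation A := (adjmx R e).

Lemma adjmx_exp_walk j u v : (A ^+ j) u v != 0 -> has_walk e j u v.
Proof.
elim: j u => [|j IHj] u.
  rewrite expr0 mxE; have [-> _|_] := eqVneq u v; last by rewrite eqxx.
  by apply/existsP; exists [tuple]; rewrite /= eqxx.
rewrite exprS mxE; apply: contraNT => nw; rewrite big1 // => w _.
have [->|/IHj wv] := eqVneq ((A ^+ j) w v) 0; first by rewrite mulr0.
rewrite mxE; case uw: (e u w); last by rewrite mul0r.
by rewrite (has_walkS uw wv) in nw.
Qed.

Lemma horner_adjmx_at_distance_4 a b c h u v :
  at_distance e 4 u v -> horner_mx A (cubic a b c h) u v = 0.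
Proof.
move=> /andP [_ /forallP nw].
have A0 j : (j < 4)%N -> (A ^+ j) u v = 0.
  move=> ltj; apply/eqP; apply: contraNT (nw (Ordinal ltj)).
  exact: adjmx_exp_walk.
(* Abstract matrices keep [mxE] from expanding the powers of [A]. *)
have comb0 (A3 A2 A1 A0' : 'M[R]_m.+1) : A3 u v = 0 -> A2 u v = 0 ->
    A1 u v = 0 -> A0' u v = 0 ->
    (a *: A3 + b *: A2 + c *: A1 + h *: A0') u v = 0.
  by rewrite !mxE => -> -> -> ->; rewrite !mulr0 !addr0.
rewrite horner_mx_cubic -scalemx1.
by apply: comb0; [exact: A0 3 isT | exact: A0 2 isT | exact: A0 1 isT | exact: A0 0 isT].
Qed.

Hypothesis e_sym : symmetric e.
Hypothesis e_irr : irreflexive e.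
Hypothesis e_reg : regular_graph e k.

Lemma adjmx_sym : A^T = A.
Proof. by apply/matrixP => u v; rewrite !mxE e_sym. Qed.

Lemma adjmx_rowsum u : \sum_v A u v = k%:R.
Proof.
under eq_bigr do rewrite mxE.
rewrite -natr_sum -(e_reg u) -sum1_card; congr _%:R.
rewrite [RHS]big_mkcond /=; apply: eq_bigr => v _.
by rewrite inE; case: (e u v).
Qed.

Lemma adjmx_colsum v : \sum_u A u v = k%:R.
Proof. by rewrite -(adjmx_rowsum v); apply: eq_bigr => u _; rewrite !mxE e_sym. Qed.

Lemma adjmx_sqr_diag u : (A ^+ 2) u u = k%:R.
Proof.
rewrite -(adjmx_rowsum u) expr2 mxE; apply: eq_bigr => v _.
by rewrite !mxE e_sym -natrM mulnb andbb.
Qed.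

(** Without loops [c] drops out, and by regularity only [(A ^+ 3) u u] depends on the vertex. *)
Lemma horner_adjmx_diag a b c h u :
  horner_mx A (cubic a b c h) u u = a * (A ^+ 3) u u + b * k%:R + h.
Proof.
rewrite horner_mx_cubic -(adjmx_sqr_diag u).
move: (A ^+ 3) (A ^+ 2) => A3 A2; rewrite !mxE e_irr eqxx.
by rewrite mulr0 addr0 mulr1n.
Qed.

Lemma Wq_cubic b c h :
  Wq A (cubic 1 b c h) = max_diag (A ^+ 3) + b * k%:R + h.
Proof.
rewrite /Wq; apply/le_anti/andP; split.
  have [u <-] := max_diag_attained (horner_mx A (cubic 1 b c h)).
  by rewrite horner_adjmx_diag mul1r !lerD2r max_diag_ge.
have [u <-] := max_diag_attained (A ^+ 3).
by rewrite -[(A ^+ 3) u u]mul1r -(horner_adjmx_diag 1 b c h) max_diag_ge.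
Qed.

(** * Constraints on the distinct eigenvalues *)

Section Spectrum.

Variables (d : nat) (lam : seq R) (theta : seq R).
Local Notation D := (max_diag (A ^+ 3)).

Hypothesis Alam : char_poly A = \prod_(x <- lam) ('X - x%:P).
Hypothesis theta_lam : theta =i lam.
Hypothesis theta_size : size theta = d.+1.
Hypothesis theta_sorted : sorted >%R theta.
Hypothesis theta0 : theta`_0 = k%:R.
Hypothesis d_ge3 : (3 <= d)%N.

Lemma theta_lt i j : (i < j)%N -> (j <= d)%N -> theta`_j < theta`_i.
Proof.
move=> ij jd; have := sorted_ltn_nth (rev_trans lt_trans) 0 theta_sorted.
by apply; rewrite ?inE ?theta_size ?ltnS ?(leq_trans (ltnW ij)).
Qed.

Lemma theta_le i j : (i <= j)%N -> (j <= d)%N -> theta`_j <= theta`_i.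
Proof.
by rewrite leq_eqVlt => /predU1P [-> //|ij jd]; apply/ltW/theta_lt.
Qed.

Lemma mem_theta j : (j <= d)%N -> theta`_j \in lam.
Proof. by move=> jd; rewrite -theta_lam mem_nth ?theta_size. Qed.

Lemma thetaP x : x \in lam -> exists2 j, (j <= d)%N & x = theta`_j.
Proof. by rewrite -theta_lam => /(nthP 0) [j]; rewrite theta_size => jd <-; exists j. Qed.

(** The value is the diagonal entry of the cubic in [A] at a vertex attaining [D]. *)
Lemma cubic_functional_ge0 a b c h :
    (forall j, (j <= d)%N -> 0 <= (cubic a b c h).[theta`_j]) ->
  0 <= a * D + b * k%:R + h.
Proof.
move=> q0; have [u <-] := max_diag_attained (A ^+ 3).
rewrite -(horner_adjmx_diag a b c h u).
apply: (horner_mx_diag_ge0 adjmx_sym Alam) => x /thetaP [j jd ->].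
exact: q0.
Qed.

(** For [0 <= a] the functional bounds every diagonal entry, so rigidity applies. *)
Lemma cubic_functional_le0 a b c h j :
    (forall j, (j <= d)%N -> 0 <= (cubic a b c h).[theta`_j]) -> 0 <= a ->
  a * D + b * k%:R + h <= 0 -> (j <= d)%N -> (cubic a b c h).[theta`_j] = 0.
Proof.
move=> q0 a0 L0 jd.
apply: (horner_mx_diag_le0_root adjmx_sym Alam _ _ (mem_theta jd)) => [x|u].
  by move=> /thetaP [i id ->]; apply: q0.
rewrite horner_adjmx_diag (le_trans _ L0) // !lerD2r ler_wpM2l //.
exact: max_diag_ge.
Qed.

(* Otherwise [(k - x)(x + 1)] is nonnegative on the spectrum, and it has zero
   diagonal at [A], so the spectrum would be contained in [{k, -1}]. *)
Lemma theta_last_ltN1 : theta`_d < - 1.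
Proof.
rewrite ltNge; apply/negP => tdN1.
have q0 j : (j <= d)%N -> 0 <= (cubic 0 (- 1) (k%:R - 1) k%:R).[theta`_j].
  move=> jd; rewrite horner_cubic -theta0.
  have := theta_le (leq0n j) jd; have := theta_le jd (leqnn d).
  move: theta`_0 theta`_j theta`_d tdN1 => x y z; nra.
have q1 j : (j <= d)%N -> (theta`_0 - theta`_j) * (theta`_j + 1) = 0.
  move=> jd; have := cubic_functional_le0 q0 (lexx 0) _ jd.
  rewrite horner_cubic mul0r add0r mulN1r addNr lexx => /(_ isT) qj0.
  by rewrite -[RHS]qj0 theta0; ring.
have [d1 d2] : (1 <= d /\ 2 <= d)%N by split; apply: leq_trans d_ge3.
have := q1 1 d1; have := q1 2 d2.
have := theta_lt (isT : (0 < 1)%N) d1; have := theta_lt (isT : (1 < 2)%N) d2.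
move=> t21 t10 /eqP; rewrite mulf_eq0 => /orP [/eqP|/eqP] ? /eqP.
  by lra.
by rewrite mulf_eq0 => /orP [/eqP|/eqP] ?; lra.
Qed.

Lemma degree_gt0 : 0 < k%:R :> R.
Proof.
rewrite lt0r ler0n andbT; apply/negP => /eqP k0.
(* If [k = 0], then [A ^+ 2] has zero diagonal and all eigenvalues are 0. *)
have q0 j : (j <= d)%N -> 0 <= (cubic 0 1 0 0).[theta`_j].
  by move=> jd; rewrite horner_cubic !mul0r !addr0 add0r mul1r sqr_ge0.
have := cubic_functional_le0 q0 (lexx 0) _ (leqnn d).
rewrite k0 mul0r mulr0 !addr0 lexx horner_cubic => /(_ isT) td2.
have td0 : theta`_d ^+ 2 = 0 by rewrite -[RHS]td2; ring.
by have := theta_last_ltN1; move: td0; rewrite expr2; nra.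
Qed.

Local Notation thr :=
  (- ((theta`_0 ^+ 2 + theta`_0 * theta`_d - D) / (theta`_0 * (theta`_d + 1)))).

(** Clearing the negative denominator turns the threshold into the sign of the functional at
    [(X - theta_0)(X - x)(X - theta_d)]. *)
Lemma le_threshold x :
  (x <= thr) = (D - k%:R * (k%:R + x + theta`_d) - k%:R * x * theta`_d <= 0).
Proof.
have td := theta_last_ltN1; have k0 := degree_gt0.
rewrite theta0 -mulNr ler_ndivlMr ?pmulr_rlt0 //; last by lra.
by rewrite -subr_le0; congr (_ <= 0); ring.
Qed.

(* This rules out [s <= 1], where [theta_(s-1)] would be [theta_0]: otherwise the
   cubic with roots [theta_0], [theta_1], [theta_d] is nonnegative on the
   spectrum with nonpositive diagonal at [A], so it vanishes at [theta_2]. *)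
Lemma theta1_gt_threshold : thr < theta`_1.
Proof.
rewrite ltNge le_threshold; apply/negP => t1thr.
have [d0 d1 d2] : [/\ 0 < d, 1 <= d & 2 <= d]%N by split; apply: leq_trans d_ge3.
have t21 := theta_lt (isT : (1 < 2)%N) d2.
have td2 := theta_lt d_ge3 (leqnn d).
have t10 := theta_lt (isT : (0 < 1)%N) d1.
pose x := theta`_0; pose y := theta`_1; pose z := theta`_d.
pose q := cubic 1 (- (x + y + z)) (x * y + x * z + y * z) (- (x * y * z)).
have qE w : q.[w] = (w - x) * (w - y) * (w - z) by rewrite horner_cubic; ring.
have q0 j : (j <= d)%N -> 0 <= q.[theta`_j].
  case: j => [|j] jd; first by rewrite qE subrr !mul0r.
  rewrite qE mulr_ge0 // ?subr_ge0 ?theta_le //.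
  by rewrite mulr_le0 // subr_le0 theta_le.
have : q.[theta`_2] = 0.
  apply: cubic_functional_le0 => //.
  by move: t1thr; rewrite /x theta0 -/y -/z; nra.
rewrite qE => /eqP; rewrite !mulf_eq0 !subr_eq0 -!orbA => /or3P [] /eqP;
  rewrite /x /y /z => ?; lra.
Qed.

(** * Position of the index [s] *)

Variable s : nat.
Hypothesis s_le : (s <= d)%N.
Hypothesis ts_le : theta`_s <= thr.
Hypothesis ts_max : forall j, (j <= d)%N -> theta`_j <= thr -> theta`_j <= theta`_s.

Lemma threshold_index_gt1 : (1 < s)%N.
Proof.
rewrite ltnNge; apply/negP => s1.
have d1 : (1 <= d)%N by apply: leq_trans d_ge3.
have := lt_le_trans theta1_gt_threshold (theta_le s1 d1).
by rewrite ltNge ts_le.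
Qed.

Lemma theta_pred_gt_threshold : thr < theta`_s.-1.
Proof.
have sP : s.-1.+1 = s := prednK (ltnW threshold_index_gt1).
have pd : (s.-1 <= d)%N by rewrite (leq_trans (leq_pred s)).
rewrite ltNge; apply/negP => /(ts_max pd).
by rewrite leNgt theta_lt // sP.
Qed.

(* If [s = d], the cubic with roots [theta_0], [theta_(d-1)], [theta_d] is
   nonpositive on the spectrum, contrary to [thr < theta_(d-1)]. *)
Lemma threshold_index_lt : (s < d)%N.
Proof.
rewrite ltn_neqAle s_le andbT; apply/negP => /eqP sd.
have := theta_pred_gt_threshold; rewrite sd ltNge le_threshold -ltNge => L0.
have dP : d.-1.+1 = d by rewrite prednK // (leq_trans _ d_ge3).
pose x := theta`_0; pose y := theta`_d.-1; pose z := theta`_d.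
pose q := cubic (- 1) (x + y + z) (- (x * y + x * z + y * z)) (x * y * z).
have qE w : q.[w] = (x - w) * ((w - y) * (w - z)) by rewrite horner_cubic; ring.
have : 0 <= - 1 * D + (x + y + z) * k%:R + x * y * z.
  apply: (@cubic_functional_ge0 _ _ (- (x * y + x * z + y * z))) => j jd.
  rewrite qE mulr_ge0 ?subr_ge0 ?theta_le //.
  move: jd; rewrite leq_eqVlt => /predU1P [->|jd]; first by rewrite subrr mulr0.
  have jd1 : (j <= d.-1)%N by rewrite -ltnS dP.
  rewrite mulr_ge0 // subr_ge0; first exact: theta_le jd1 (leq_pred d).
  exact: theta_le (ltnW jd) (leqnn d).
by rewrite /x theta0 -/y -/z in L0 *; move: L0; lra.
Qed.

(** * The optimal cubic and its dual certificate *)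

Local Notation ts := theta`_s.
Local Notation ts1 := theta`_s.-1.
Local Notation td := theta`_d.
Local Notation tau := (ts * ts1 * td).
Local Notation b := (- (ts + ts1 + td)).
Local Notation c := (td * ts + td * ts1 + ts * ts1).

Lemma horner_optimal h x :
  (cubic 1 b c h).[x] = (x - ts) * (x - ts1) * (x - td) + tau + h.
Proof. by rewrite horner_cubic; ring. Qed.

Lemma optimal_nodes_lt : [/\ td < ts, ts < ts1 & ts1 < theta`_0].
Proof.
have s_gt1 := threshold_index_gt1; have sP : s.-1.+1 = s := prednK (ltnW s_gt1).
have s1d : (s.-1 <= d)%N by rewrite (leq_trans (leq_pred s)).
split; first exact: theta_lt threshold_index_lt (leqnn d).
  by apply: (@theta_lt s.-1 s) => //; rewrite sP.
by apply: (@theta_lt 0 s.-1) => //; rewrite -ltnS sP.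
Qed.

(** No eigenvalue lies strictly between two consecutive ones, so both factors have the same sign. *)
Lemma consecutive_theta_ge0 j :
  (j <= d)%N -> 0 <= (theta`_j - ts) * (theta`_j - ts1).
Proof.
move=> jd; have sP : s.-1.+1 = s := prednK (ltnW threshold_index_gt1).
have s1d : (s.-1 <= d)%N by rewrite (leq_trans (leq_pred s)).
have [js|sj] := ltnP j s.
  have js1 : (j <= s.-1)%N by rewrite -ltnS sP.
  by rewrite mulr_ge0 // subr_ge0; [exact: theta_le (ltnW js) s_le | exact: theta_le].
rewrite mulr_le0 // subr_le0; first exact: theta_le.
exact: theta_le (leq_trans (leq_pred s) sj) jd.
Qed.

Lemma optimal_ge0 j : (j <= d)%N -> 0 <= (cubic 1 b c (- tau)).[theta`_j].
Proof.
move=> jd; rewrite horner_optimal addrK.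
rewrite mulr_ge0 ?consecutive_theta_ge0 // subr_ge0.
exact: theta_le jd (leqnn d).
Qed.

Lemma optimal_functional_le a2 a1 a0 a3 :
    let f := cubic a3 a2 a1 a0 in
    (forall j, (0 < j)%N -> (j <= d)%N -> 0 <= f.[theta`_j]) ->
  (D - k%:R * (ts + ts1 + td) - tau)
    / ((theta`_0 - ts) * (theta`_0 - ts1) * (theta`_0 - td)) * f.[theta`_0]
  <= a3 * D + a2 * k%:R + a0.
Proof.
move=> f f0; have [lt_ds lt_ss1 lt_s10] := optimal_nodes_lt.
have k0 := degree_gt0.
have s_gt1 := threshold_index_gt1; have lt_sd := threshold_index_lt.
have s1_gt0 : (0 < s.-1)%N by rewrite -ltnS prednK ?(ltnW s_gt1).
have s1d : (s.-1 <= d)%N by rewrite (leq_trans (leq_pred s)).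
have fs := f0 s (ltnW s_gt1) s_le; have fs1 := f0 _ s1_gt0 s1d.
have fd := f0 d (leq_trans (isT : (0 < 3)%N) d_ge3) (leqnn d).
(* [Ls], [Ls1] and [Ld] give the signs of the weight numerators at [ts], [ts1] and [td]. *)
have Ls := theta_pred_gt_threshold; rewrite ltNge le_threshold -ltNge in Ls.
have Ls1 := ts_le; rewrite le_threshold in Ls1.
have Ld : 0 <= - 1 * D + (theta`_0 + ts + ts1) * k%:R + theta`_0 * ts * ts1.
  apply: (@cubic_functional_ge0 _ _
    (- (theta`_0 * ts + theta`_0 * ts1 + ts * ts1))) => j jd.
  rewrite horner_cubic.
  have -> : - 1 * theta`_j ^+ 3 + (theta`_0 + ts + ts1) * theta`_j ^+ 2
     + - (theta`_0 * ts + theta`_0 * ts1 + ts * ts1) * theta`_j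
     + theta`_0 * ts * ts1 =
     (theta`_0 - theta`_j) * ((theta`_j - ts) * (theta`_j - ts1)) by ring.
  rewrite mulr_ge0 ?consecutive_theta_ge0 // subr_ge0.
  exact: theta_le (leq0n j) jd.
move: Ls Ls1 Ld fs fs1 fd; rewrite /f -theta0.
(* The nodes are ordered [x3 < x1 < x2 < x0], so the weight denominators are positive at [x1] and
   negative at [x2] and [x3]. *)
move: theta`_0 ts ts1 td lt_ds lt_ss1 lt_s10 => x0 x1 x2 x3 lt31 lt12 lt20.
move=> L1 L2 L3 f1 f2 f3.
have lt10 := lt_trans lt12 lt20; have lt32 := lt_trans lt31 lt12.
have lt30 := lt_trans lt32 lt20.
have w1 : 0 <= (D - x0 * (x0 + x2 + x3) - x0 * x2 * x3)
    / ((x1 - x0) * (x1 - x2) * (x1 - x3)).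
  rewrite divr_ge0 ?(ltW L1) // mulr_ge0 ?subr_ge0 ?(ltW lt31) //.
  by rewrite mulr_le0 // subr_le0 ltW.
have w2 : 0 <= (D - x0 * (x0 + x1 + x3) - x0 * x1 * x3)
    / ((x2 - x0) * (x2 - x1) * (x2 - x3)).
  rewrite mulr_le0 // invr_le0 mulr_le0_ge0 ?subr_ge0 ?(ltW lt32) //.
  by rewrite mulr_le0_ge0 ?subr_ge0 ?subr_le0 ?ltW.
have w3 : 0 <= (D - x0 * (x0 + x1 + x2) - x0 * x1 * x2)
    / ((x3 - x0) * (x3 - x1) * (x3 - x2)).
  rewrite mulr_le0 //; first by move: L3; lra.
  by rewrite invr_le0 mulr_ge0_le0 ?mulr_le0 ?subr_le0 ?ltW.
(* The linear coefficient [a1] does not occur in the functional, so it is supplied by hand. *)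
rewrite [leRHS](@cubic_quadrature _ x0 D x1 x2 x3 _ _ a1);
  rewrite ?(lt_eqF lt12) ?gt_eqF //.
apply: ler_wpDr; first exact: mulr_ge0 w3 f3.
apply: ler_wpDr; first exact: mulr_ge0 w2 f2.
by apply: ler_wpDr; first exact: mulr_ge0 w1 f1.
Qed.

End Spectrum.
End RegularGraph.

(** * Ratio bound, closed form and optimality *)

Unset Implicit Arguments.

Theorem corollary18 (R : realType) (m : nat) (e : rel 'I_m.+1) (k d : nat)
    (lam : m.+1.-tuple R) (theta : d.+1.-tuple R) (s : nat) :
  let A : 'M[R]_m.+1 := adjmx R e in
  let Delta3 : R := max_diag (A ^+ 3) in
  let t0 : R := theta`_0 in
  let td : R := theta`_d in
  let ts : R := theta`_s in
  let ts1 : R := theta`_s.-1 in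
  let threshold : R := - ((t0 ^+ 2 + t0 * td - Delta3) / (t0 * (td + 1))) in
  let b : R := - (ts + ts1 + td) in
  let c : R := td * ts + td * ts1 + ts * ts1 in
  let p : {poly R} := 'X^3 + b *: 'X^2 + c *: 'X in
  simple_graph e ->
  regular_graph e k ->
  is_spectrum A lam ->
  is_distinct_spectrum A theta ->
  t0 = k%:R ->
  (3 <= d)%N ->
  (s <= d)%N ->
  ts <= threshold ->
  (forall j : nat, (j <= d)%N -> theta`_j <= threshold -> theta`_j <= ts) ->
  [/\ lambdaq lam p < p.[lam`_0],
      (eq_number e 4)%:R <= Rq A lam p,
      Rq A lam p = m.+1%:R * ((Delta3 - t0 * (ts + ts1 + td) - ts * ts1 * td)
                     / ((t0 - ts) * (t0 - ts1) * (t0 - td)))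
    & forall q : {poly R}, (size q <= 4)%N ->
        lambdaq lam q < q.[lam`_0] -> Rq A lam p <= Rq A lam q].
Proof.
move=> A Delta3 t0 td ts ts1 threshold b c p [e_sym e_irr] e_reg [lam_sorted Alam].
move=> [theta_sorted theta_eig] t0k d_ge3 s_le ts_le ts_max.
have theta_lam : theta =i lam by move=> x; rewrite theta_eig (eigenvalue_mem Alam).
have theta_size := size_tuple theta.
have lam0 : lam`_0 = t0.
  apply/le_anti/andP; split.
    have : lam`_0 \in lam by rewrite mem_nth ?size_tuple.
    move=> /(thetaP theta_lam theta_size) [j jd ->].
    by rewrite /t0 (theta_le theta_size theta_sorted (leq0n j) jd).
  have : t0 \in lam by rewrite -theta_lam mem_nth ?theta_size.
  move=> /(nthP 0) [j jm <-].
  by apply: (sorted_leq_nth (rev_trans le_trans) lexx 0 lam_sorted);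
    rewrite ?inE ?size_tuple // -(size_tuple lam).
have pE h : p + h%:P = cubic 1 b c h by rewrite /p /cubic scale1r.
have pE0 : p = cubic 1 b c 0 by rewrite -pE addr0.
set tau := ts * ts1 * td.
have [lt_ds lt_ss1 lt_s10] := optimal_nodes_lt e_sym e_irr e_reg Alam theta_lam
  theta_size theta_sorted t0k d_ge3 s_le ts_le ts_max.
have p_tau x : p.[x] = (x - ts) * (x - ts1) * (x - td) + tau.
  by rewrite pE0 horner_optimal addr0.
have p_ge x : x \in lam -> tau <= p.[x].
  move=> /(thetaP theta_lam theta_size) [j jd ->].
  rewrite p_tau -subr_ge0 addrK.
  have := optimal_ge0 e_sym e_irr e_reg Alam theta_lam theta_size theta_sorted
    t0k d_ge3 s_le ts_le jd.
  by rewrite horner_optimal addrK.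
(* [p - tau] is nonnegative on the spectrum and vanishes at [ts], which differs from [lam_0]. *)
have lambda_p : lambdaq lam p = tau.
  have s_lam : ts \in lam by rewrite -theta_lam mem_nth ?theta_size.
  have s_neq : ts != lam`_0 by rewrite lam0 lt_eqF // (lt_trans lt_ss1).
  apply/le_anti/andP; split.
    by apply: le_trans (lambdaq_le _ s_lam s_neq) _; rewrite p_tau subrr !mul0r add0r.
  apply: le_lambdaq => //.
  (* Since [ts] occurs at a positive index, there are at least two eigenvalues. *)
  move: s_lam => /(nthP 0) [[|j] jm sj]; first by rewrite sj eqxx in s_neq.
  by move: jm; rewrite size_tuple; case: (m).
have p0_gt : 0 < (t0 - ts) * (t0 - ts1) * (t0 - td).
  have lt_s0 := lt_trans lt_ss1 lt_s10; have lt_d0 := lt_trans lt_ds lt_s0.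
  by rewrite !mulr_gt0 // subr_gt0.
have p0E : p.[lam`_0] - tau = (t0 - ts) * (t0 - ts1) * (t0 - td).
  by rewrite lam0 p_tau addrK.
have W_p : Wq A p - tau = Delta3 - t0 * (ts + ts1 + td) - tau.
  by rewrite pE0 (Wq_cubic e_sym e_irr e_reg) t0k /b /Delta3; ring.
have R_p : Rq A lam p = m.+1%:R * ((Delta3 - t0 * (ts + ts1 + td) - tau)
    / ((t0 - ts) * (t0 - ts1) * (t0 - td))).
  by rewrite /Rq lambda_p p0E W_p.
split=> //.
- by rewrite lambda_p -subr_gt0 p0E.
- rewrite /Rq lambda_p p0E.
  have card_bound S : equidistant e 4 S ->
      #|S|%:R <= m.+1%:R * ((Wq A p - tau) / ((t0 - ts) * (t0 - ts1) * (t0 - td))).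
    move=> eqS; rewrite mulrA ler_pdivlMr // -p0E.
    have qE x : (cubic 1 b c (- tau)).[x] = p.[x] - tau.
      by rewrite -pE hornerD hornerC.
    rewrite -qE lam0 t0k.
    apply: (card_le_horner_mx (adjmx_sym _ e_sym) Alam (adjmx_colsum _ e_sym e_reg)).
    + by move=> x /p_ge; rewrite qE subr_ge0.
    + by rewrite -t0k -theta_lam mem_nth ?theta_size.
    + move=> u; rewrite -pE rmorphD /= horner_mx_C mxE mxE eqxx mulr1n lerD2r.
      exact: max_diag_ge.
    + move=> u v uS vS uv; apply: horner_adjmx_at_distance_4.
      by move: eqS => /forall_inP/(_ u uS)/forall_inP/(_ v vS)/implyP/(_ uv).
  rewrite /eq_number; elim/big_ind: _ => [|x y|S]; last exact: card_bound.
    (* The default value 0 of the maximum is bounded through the empty set. *)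
    by rewrite -(@cards0 'I_m.+1) card_bound //; apply/forall_inP => u; rewrite inE.
  by rewrite /maxn; case: ifP.
- move=> q q4 lt_q; rewrite R_p /Rq ler_pM2l ?ltr0Sn //.
  set l := lambdaq lam q in lt_q *.
  have q0_gt : 0 < q.[lam`_0] - l by rewrite subr_gt0.
  rewrite ler_pdivlMr //.
  (* [f = q - lambda(q)] is nonnegative at every eigenvalue other than [theta_0]. *)
  pose f := cubic q`_3 q`_2 q`_1 (q`_0 - l).
  have fE x : f.[x] = q.[x] - l.
    by rewrite [in RHS](cubicE q4) !horner_cubic addrA.
  have f_ge0 j : (0 < j)%N -> (j <= d)%N -> 0 <= f.[theta`_j].
    move=> j0 jd; rewrite fE subr_ge0 lambdaq_le //.
      by rewrite -theta_lam mem_nth ?theta_size.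
    rewrite lam0 lt_eqF //.
    by rewrite /t0 (theta_lt theta_size theta_sorted j0 jd).
  have := optimal_functional_le e_sym e_irr e_reg Alam theta_lam theta_size
    theta_sorted t0k d_ge3 s_le ts_le ts_max f_ge0.
  rewrite -t0k -fE lam0 => /le_trans; apply.
  (* At a vertex attaining [Delta3], the functional of [f] is [q(A)_uu - l], at most [W(q) - l]. *)
  have [u uD] := max_diag_attained (A ^+ 3).
  rewrite -uD addrA lerD2r t0k -(horner_adjmx_diag e_sym e_irr e_reg _ _ q`_1).
  by rewrite -cubicE // max_diag_ge.
Qed.
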